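(* Let $\mathbf{k}$ be a multi-index with $\operatorname{wt}(\mathbf{k})=-1$, and set $n:=|\mathbf{k}|$. Then $$L_{\mathbf{k}}=\frac{n!\,(n-1)!}{\prod_{a\in A}\prod_{j\ge -1} k_j^a!\,\big((j+1)!\big)^{k_j^a}},$$ and therefore $$W_{\mathbf{k}}=\frac{(n-1)!}{\prod_{a\in A}\prod_{j\ge -1} k_j^a!\,\big((j+1)!\big)^{k_j^a}}.$$
   Context: $A$ is a finite set (of decorations) and $I_A:=A\times\mathbb{Z}_{\ge -1}$. A multi-index is a finitely supported map $\mathbf{k}:I_A\to\mathbb{Z}_{\ge 0}$, written $k_j^a:=\mathbf{k}(a,j)$; set $|\mathbf{k}|=\sum_{a,j}k_j^a$ and $\operatorname{wt}(\mathbf{k})=\sum_{a,j}j\,k_j^a$ (sums over $a\in A$, $j\ge -1$). An $A$-decorated rooted tree is a finite rooted tree $t$ with a map $d:V(t)\to A$; isomorphisms preserve the root and the decorations. The fertility $f(v)$ of a vertex $v$ is its number of children. The profile of $t$ is the multi-index $\mathbf{k}(t)$ with $k_j^a(t)=\#\{v\in V(t): d(v)=a,\ f(v)=j+1\}$. Let $\mathcal{F}_{\mathbf{k}}$ be the (finite) set of isomorphism classes of $A$-decorated rooted trees with profile $\mathbf{k}$; put $\sigma(t):=|\operatorname{Aut}(t)|$ and $$W_{\mathbf{k}}:=\sum_{t\in\mathcal{F}_{\mathbf{k}}}\frac{1}{\sigma(t)}.$$ For a finite set $I$, a labelled $A$-decorated rooted tree on $I$ is an $A$-decorated rooted tree whose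 vertex set is exactly $I$. $L_{\mathbf{k}}$ denotes the number of labelled $A$-decorated rooted trees on $I$ with profile $\mathbf{k}$, for any finite set $I$ with $|I|=|\mathbf{k}|$ (this number depends only on $|I|$). *)

(* Defs.v *)
From HB Require Import structures.
From mathcomp Require Import all_boot all_order all_algebra.
From mathcomp Require Import finmap.

Set Implicit Arguments.
Unset Strict Implicit.
Unset Printing Implicit Defensive.

Import Order.TTheory GRing.Theory Num.Theory.
Local Open Scope ring_scope.

Definition idx : Type := {j : int | -1 <= j}.

Section MultiIndex.
Variable A : finType.

Definition multiindex : Type := {fsfun (A * idx)%type -> nat with 0%N}.

Implicit Type k : multiindex.

Definition mabs k : nat := (\sum_(i <- finsupp k) k i)%N.

Definition wt k : int := \sum_(i <- finsupp k) val i.2 *+ k i.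

(* Indices outside the support of k contribute a factor 0! * ((j + 1)!) ^ 0 = 1.
   Since j + 1 >= 0, the absolute value is just the cast from int to nat. *)
Definition kprod k : nat :=
  (\prod_(i <- finsupp k) ((k i)`! * (absz (val i.2 + 1)%R)`! ^ k i))%N.

End MultiIndex.

(* E is the set of pairs (parent, child). *)
Definition is_rooted_tree (V : finType) (r : V) (E : {set V * V}) : bool :=
  [&& [forall x, (x, r) \notin E],
      [forall x, (x != r) ==> (#|[set y | (y, x) \in E]| == 1%N)] &
      [forall x, connect [rel u v | (u, v) \in E] r x]].

Section Trees.
Variable A : finType.

(* The A-decorated rooted trees with vertex set exactly V: a root, a set of
   (parent, child) edges and a decoration. *)
Definition dtree (V : finType) : Type :=
  {t : V * {set V * V} * {ffun V -> A} | is_rooted_tree t.1.1 t.1.2}.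

Definition root (V : finType) (t : dtree V) : V := (val t).1.1.
Definition edges (V : finType) (t : dtree V) : {set V * V} := (val t).1.2.
Definition dec (V : finType) (t : dtree V) : {ffun V -> A} := (val t).2.

Definition fertility (V : finType) (t : dtree V) (v : V) : nat :=
  #|[set w | (v, w) \in edges t]|.

Fact predz_ge (m : nat) : -1 <= m%:Z - 1.
Proof. by rewrite lerBrDr addNr. Qed.

Definition predz (m : nat) : idx := exist _ (m%:Z - 1) (predz_ge m).

(* The count vanishes outside the displayed finite set, see profileE. *)
Definition profile (V : finType) (t : dtree V) : multiindex A :=
  [fsfun i in [fset (dec t v, predz (fertility t v)) | v in V]%fset =>
     #|[set v | (dec t v == i.1) && ((fertility t v)%:Z == val i.2 + 1)]|
   | 0%N].

Lemma profileE (V : finType) (t : dtree V) (i : A * idx) :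
  profile t i =
    #|[set v | (dec t v == i.1) && ((fertility t v)%:Z == val i.2 + 1)]|.
Proof.
rewrite fsfun_fun; case: ifPn => // i_out; apply/esym/eqP.
rewrite cards_eq0; apply/eqP/setP => v; rewrite !inE.
apply: contraNF i_out => /andP[/eqP di /eqP fi].
apply/imfsetP; exists v => //; rewrite di [LHS]surjective_pairing.
by congr (_, _); apply/val_inj; rewrite /= fi addrK.
Qed.

Lemma mabs_profile (V : finType) (t : dtree V) : mabs (profile t) = #|V|.
Proof.
pose g v := (dec t v, predz (fertility t v)).
have gE v i : (g v == i) =
    (dec t v == i.1) && ((fertility t v)%:Z == val i.2 + 1).
  case: i => a j; rewrite xpair_eqE /= -val_eqE /=.
  by rewrite subr_eq.
have gS v : g v \in finsupp (profile t).
  rewrite mem_finsupp profileE -lt0n; apply/card_gt0P; exists v.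
  by rewrite inE -gE.
rewrite /mabs (eq_bigr (fun i => \sum_(v : V | g v == i) 1)%N); last first.
  by move=> i _; rewrite profileE -sum1_card; apply: eq_bigl => v; rewrite inE gE.
rewrite -sum1_card (exchange_big_dep xpredT) //=; apply: eq_bigr => v _.
rewrite (eq_bigl (pred1 (g v))) => [|i]; last by rewrite /= eq_sym.
rewrite -big_filter filter_pred1_uniq ?fset_uniq //.
by rewrite big_seq1.
Qed.

Definition is_iso (V W : finType) (t : dtree V) (u : dtree W)
    (f : {ffun V -> W}) : bool :=
  [&& injectiveb f, [forall y, y \in codom f],
      f (root t) == root u,
      [forall x, forall y, ((f x, f y) \in edges u) == ((x, y) \in edges t)] &
      [forall x, dec u (f x) == dec t x]].

Definition isomorphic (V W : finType) (t : dtree V) (u : dtree W) : bool :=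
  [exists f : {ffun V -> W}, is_iso t u f].

Lemma isomorphicP (V W : finType) (t : dtree V) (u : dtree W) :
  reflect (exists f : V -> W, [/\ bijective f, f (root t) = root u,
      (forall x y, ((f x, f y) \in edges u) = ((x, y) \in edges t)) &
      (forall x, dec u (f x) = dec t x)])
    (isomorphic t u).
Proof.
apply: (iffP existsP) => [[f /and5P[/injectiveP inj_f /forallP sur_f]]|[f]].
  move=> /eqP rf /forallP ef /forallP df; exists f; split=> //.
  - apply: inj_card_bij => //.
    rewrite -(card_codom inj_f); apply: subset_leq_card.
    by apply/subsetP => y _; apply: sur_f.
  - by move=> x y; apply/eqP; move/forallP: (ef x); apply.
  - by move=> x; apply/eqP/df.
case=> bij_f rf ef df; exists (finfun f); apply/and5P; split.
- by apply/injectiveP => x y; rewrite !ffunE; apply: bij_inj.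
- apply/forallP => y; case: bij_f => g _ gK.
  by apply/codomP; exists (g y); rewrite ffunE gK.
- by rewrite ffunE rf.
- by apply/forallP => x; apply/forallP => y; rewrite !ffunE ef.
- by apply/forallP => x; rewrite ffunE df.
Qed.

Lemma isomorphic_refl (V : finType) (t : dtree V) : isomorphic t t.
Proof. by apply/isomorphicP; exists id; split=> //; exists id. Qed.

Lemma isomorphic_sym (V W : finType) (t : dtree V) (u : dtree W) :
  isomorphic t u -> isomorphic u t.
Proof.
move=> /isomorphicP[f [[g fK gK] rf ef df]]; apply/isomorphicP; exists g.
split; first by exists f.
- by rewrite -rf fK.
- by move=> x y; rewrite -ef !gK.
- by move=> x; rewrite -df gK.
Qed.

Lemma isomorphic_trans (U V W : finType)
    (s : dtree U) (t : dtree V) (u : dtree W) :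
  isomorphic s t -> isomorphic t u -> isomorphic s u.
Proof.
move=> /isomorphicP[f [bf rf ef df]] /isomorphicP[g [bg rg eg dg]].
apply/isomorphicP; exists (g \o f); split; first exact: bij_comp.
- by rewrite /= rf rg.
- by move=> x y; rewrite /= eg ef.
- by move=> x; rewrite /= dg df.
Qed.

Lemma isomorphic_equiv (V : finType) :
  equivalence_rel (@isomorphic V V).
Proof.
move=> s t u; split=> [|st]; first exact: isomorphic_refl.
by apply/idP/idP; apply: isomorphic_trans; [apply: isomorphic_sym|].
Qed.

Lemma isomorphic_profile (V W : finType) (t : dtree V) (u : dtree W) :
  isomorphic t u -> profile t = profile u.
Proof.
move=> /isomorphicP[f [[g fK gK] rf ef df]]; apply/fsfunP => i.
have fert x : fertility u (f x) = fertility t x.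
  rewrite /fertility -(card_imset _ (can_inj fK)); apply: eq_card => y.
  rewrite -[y]gK inE ef (mem_imset _ _ (can_inj fK)) inE.
  by [].
rewrite !profileE -(card_imset _ (can_inj fK)); apply: eq_card => y.
by rewrite -[y]gK (mem_imset _ _ (can_inj fK)) !inE df fert.
Qed.

Lemma isomorphic_ord (V : finType) (n : nat) (t : dtree V) :
  #|V| = n -> exists u : dtree 'I_n, isomorphic t u.
Proof.
move=> cV.
pose f (x : V) : 'I_n := cast_ord cV (enum_rank x).
pose g (i : 'I_n) : V := enum_val (cast_ord (esym cV) i).
have fK : cancel f g by move=> x; rewrite /g /f cast_ordK enum_rankK.
have gK : cancel g f by move=> x; rewrite /g /f enum_valK cast_ordKV.
pose E := [set p | (g p.1, g p.2) \in edges t].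
have tree_E : is_rooted_tree (f (root t)) E.
  have /and3P[/forallP r0 /forallP r1 /forallP rc] := valP t.
  apply/and3P; split; apply/forallP => x.
  - by rewrite inE /= fK; apply: r0.
  - apply/implyP => xr; have := implyP (r1 (g x)) _.
    rewrite (can2_eq gK fK) => /(_ xr) /eqP <-; apply/eqP.
    rewrite -(card_imset _ (can_inj fK)); apply: eq_card => y.
    by rewrite -[y]gK (mem_imset _ _ (can_inj fK)) !inE /= !fK.
  - rewrite -[x]gK; have /connectP[p ep ->] := rc (g x).
    apply/connectP; exists (map f p); last by rewrite last_map.
    rewrite path_map; apply: sub_path ep => y z /=.
    by rewrite inE /= !fK.
exists (exist _ (f (root t), E, [ffun i => dec t (g i)]) tree_E
  : dtree 'I_n).
apply/isomorphicP; exists f; split=> //; first by exists g.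
- by move=> x y; rewrite inE /= !fK.
- by move=> x; rewrite /dec /= ffunE fK.
Qed.

Definition sigma (V : finType) (t : dtree V) : nat :=
  #|[set f : {ffun V -> V} | is_iso t t f]|.

Lemma sigma_isomorphic (V W : finType) (t : dtree V) (u : dtree W) :
  isomorphic t u -> sigma t = sigma u.
Proof.
suff le_sigma (V' W' : finType) (t' : dtree V') (u' : dtree W') :
    isomorphic t' u' -> (sigma t' <= sigma u')%N.
  move=> tu; apply/eqP; rewrite eqn_leq !le_sigma //.
  exact: isomorphic_sym.
move=> /isomorphicP[f [[g fK gK] rf ef df]].
pose c (h : {ffun V' -> V'}) : {ffun W' -> W'} := [ffun y => f (h (g y))].
have inj_c : injective c.
  move=> h h' /ffunP chh'; apply/ffunP => x; have := chh' (f x).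
  by rewrite !ffunE fK => /(can_inj fK).
rewrite /sigma -(card_imset _ inj_c); apply: subset_leq_card.
apply/subsetP => _ /imsetP[h + ->]; rewrite !inE.
case/and5P=> /injectiveP inj_h /forallP sur_h /eqP rh /forallP eh /forallP dh.
apply/and5P; split.
- apply/injectiveP => x y; rewrite !ffunE => /(can_inj fK)/inj_h.
  exact: (can_inj gK).
- apply/forallP => y; have /codomP[x gy] := sur_h (g y).
  by apply/codomP; exists (f x); rewrite ffunE fK -gy gK.
- by rewrite ffunE -rf fK rh.
- apply/forallP => x; apply/forallP => y; rewrite !ffunE ef.
  by rewrite (eqP (forallP (eh (g x)) (g y))) -ef !gK.
- by apply/forallP => x; rewrite ffunE df (eqP (dh (g x))) -df gK.
Qed.

Definition trees_on (I : finType) (k : multiindex A) : {set dtree I} :=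
  [set t : dtree I | profile t == k].

Definition L (I : finType) (k : multiindex A) : nat := #|trees_on I k|.

(* A tree with profile k has mabs k vertices (mabs_profile), hence it is
   isomorphic to a tree on 'I_(mabs k); see ex_representative. *)
Definition F (k : multiindex A) : {set {set dtree 'I_(mabs k)}} :=
  equivalence_partition (@isomorphic 'I_(mabs k) 'I_(mabs k))
    (trees_on 'I_(mabs k) k).

(* The transversal contains exactly one tree of each isomorphism class; by
   sigma_isomorphic the sum does not depend on its choice. *)
Definition W (k : multiindex A) : rat :=
  \sum_(t in transversal (F k) (trees_on 'I_(mabs k) k)) (sigma t)%:R^-1.

Lemma ex_representative (V : finType) (t : dtree V) (k : multiindex A) :
  profile t = k ->
  exists! u : dtree 'I_(mabs k),
    u \in transversal (F k) (trees_on 'I_(mabs k) k) /\ isomorphic t u.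
Proof.
move=> tk; pose T := trees_on 'I_(mabs k) k.
have eqR : {in T & &, equivalence_rel (@isomorphic 'I_(mabs k) 'I_(mabs k))}.
  by move=> x y z _ _ _; apply: isomorphic_equiv.
have FP : partition (F k) T by apply: equivalence_partitionP.
have trF := transversalP FP.
have [u0 tu0] : exists u : dtree 'I_(mabs k), isomorphic t u.
  by apply: isomorphic_ord; rewrite -tk mabs_profile.
have u0T : u0 \in T by rewrite inE -(isomorphic_profile tu0) tk.
have tiF : trivIset (F k) by case/and3P: FP.
have cF : cover (F k) = T by case/and3P: FP => /eqP.
pose B := pblock (F k) u0.
have BF : B \in F k by rewrite pblock_mem // cF.
pose u := transversal_repr u0 (transversal (F k) T) B.
have uX : u \in transversal (F k) T by apply: (repr_mem_transversal trF).
have uB : u \in B by apply: (repr_mem_pblock trF).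
have sXT := subsetP (transversal_sub trF).
have isoB v : v \in T -> (v \in B) = isomorphic u0 v.
  by move=> vT; rewrite pblock_equivalence_partition.
exists u; split.
  split=> //; apply: isomorphic_trans tu0 _.
  by rewrite -isoB // sXT.
move=> v [vX tv]; apply: (pblock_inj trF) => //.
rewrite (def_pblock tiF BF uB) (def_pblock tiF BF) //.
rewrite isoB ?sXT //; exact: isomorphic_trans (isomorphic_sym tu0) tv.
Qed.

End Trees.

(* Main.v *)
Require Import Defs.
From HB Require Import structures.
From mathcomp Require Import all_boot all_order all_algebra.
From mathcomp Require Import finmap.

(* Removing a fixed leaf shows by induction on the number of vertices that the
   number of rooted trees on an n-element set with prescribed fertilities c(v)
   of total n - 1 is the multinomial coefficient (n - 1)! / \prod_v c(v)!. The
   number of ways to assign to the vertices pairs (decoration, fertility - 1) so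
   that (a, j) is used k_j^a times is n! / \prod k_j^a!, and the product of both
   counts is L_k. By orbit counting, the isomorphism class of a tree t
   inside the trees on a fixed n-element set has n! / sigma(t) elements, so
   W_k = L_k / n!. *)

Import Order.TTheory GRing.Theory Num.Theory.
Local Open Scope ring_scope.

(** * Rooted trees on a subset with prescribed fertilities *)

Section TreesOnSubset.
Set Implicit Arguments.
Unset Strict Implicit.
Local Open Scope nat_scope.
Context {V : finType}.
Implicit Types (S : {set V}) (E : {set V * V}) (c : V -> nat).

Definition outdeg E x := #|[set y | (x, y) \in E]|.

(* The vertex set is a subset of a fixed type, so that deleting a leaf does not
   change the type. *)
Definition is_tree_on S r E : bool :=
  [&& r \in S, E \subset setX S S, [forall x, (x, r) \notin E],
      [forall x in S, (x != r) ==> (#|[set y | (y, x) \in E]| == 1)] &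
      [forall x in S, connect [rel u v | (u, v) \in E] r x]].

Lemma is_tree_onP S r E :
  reflect [/\ r \in S, forall x y, (x, y) \in E -> x \in S /\ y \in S,
      forall x, (x, r) \notin E,
      forall x, x \in S -> x != r ->
        exists y, forall z, ((z, x) \in E) = (z == y) &
      forall x, x \in S -> connect [rel u v | (u, v) \in E] r x]
    (is_tree_on S r E).
Proof.
apply: (iffP and5P) => [] [rS ES rE pE cE]; split=> //.
- by move=> x y /(subsetP ES); rewrite inE => /andP.
- by move=> x; apply/(forallP rE).
- move=> x xS xr; have /cards1P[y /setP Ey] := implyP (forall_inP pE x xS) xr.
  by exists y => z; have := Ey z; rewrite !inE.
- by move=> x xS; apply: (forall_inP cE).
- by apply/subsetP=> -[x y] /ES[xS yS]; rewrite inE; apply/andP.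
- exact/forallP.
- apply/forall_inP=> x xS; apply/implyP=> xr; have [y Ey] := pE x xS xr.
  by apply/cards1P; exists y; apply/setP=> z; rewrite !inE Ey.
- exact/forall_inP.
Qed.

Lemma is_tree_on_setT r E : is_tree_on setT r E = is_rooted_tree r E.
Proof.
rewrite /is_tree_on /is_rooted_tree inE /=.
have -> : E \subset setX setT setT by apply/subsetP => x; rewrite !inE.
by congr [&& _, _ & _]; congr andb; apply: eq_forallb => x; rewrite inE.
Qed.

Lemma add_leaf S r E p v : v \in S -> p \in S :\ v ->
  is_tree_on (S :\ v) r E -> is_tree_on S r ((p, v) |: E).
Proof.
move=> vS; rewrite !inE => /andP[pv pS] /is_tree_onP[rSv ES rE pE cE].
have [rv rS] : r != v /\ r \in S by move: rSv; rewrite !inE => /andP.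
have Sv x : x \in S -> x != v -> x \in S :\ v by rewrite !inE => -> ->.
have conE x : x \in S -> x != v ->
    connect [rel u w | (u, w) \in (p, v) |: E] r x.
  move=> xS xv; apply: connect_sub (cE x (Sv x xS xv)) => y z /= yz.
  by apply: connect1; rewrite /= !inE yz orbT.
apply/is_tree_onP; split=> //.
- move=> x y; rewrite !inE => /orP[/eqP[-> ->]//|/ES].
  by rewrite !inE => -[/andP[_ ->] /andP[_ ->]].
- by move=> x; rewrite !inE negb_or rE xpair_eqE (negbTE rv) andbF.
- move=> x xS xr; have [->|xv] := eqVneq x v.
    exists p => z; rewrite !inE xpair_eqE eqxx andbT.
    by case: eqP => //= _; apply/negP => /ES[_]; rewrite !inE eqxx.
  have [y Ey] := pE x (Sv x xS xv) xr; exists y => z.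
  by rewrite !inE xpair_eqE (negbTE xv) andbF Ey.
(* The old paths survive, and [v] is reached by first going to its parent [p]. *)
- move=> x xS; have [->|xv] := eqVneq x v; last exact: conE.
  apply: connect_trans (conE p pS pv) _.
  by apply: connect1; rewrite /= !inE eqxx.
Qed.

(** No edge leaves [v], so a path from the root to another vertex never passes through [v] and
    survives the deletion. *)
Lemma remove_leaf S r E p v :
    is_tree_on S r E -> (forall w, (v, w) \notin E) -> (p, v) \in E ->
  p \in S :\ v /\ is_tree_on (S :\ v) r (E :\ (p, v)).
Proof.
move=> /is_tree_onP[rS ES rE pE cE] leafv pvE.
have pv : p != v by apply: contraTneq pvE => ->.
have rv : r != v by apply: contraTneq pvE => <-.
have [pS vS] := ES p v pvE.
have parv z : ((z, v) \in E) = (z == p).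
  have [y Ey] := pE v vS (ltac:(by rewrite eq_sym)).
  by move: pvE; rewrite !Ey => /eqP ->.
split; first by rewrite !inE pv.
apply/is_tree_onP; split=> //.
- by rewrite !inE rv.
- move=> x y; rewrite !inE => /andP[xy xyE].
  have [-> ->] := ES x y xyE; rewrite !andbT; split.
    by apply: contraTneq xyE => ->.
  by apply: contraNneq xy => yv; move: xyE; rewrite yv parv xpair_eqE eqxx andbT.
- by move=> x; rewrite !inE negb_and rE orbT.
- move=> x; rewrite !inE => /andP[xv xS] xr; have [y Ey] := pE x xS xr.
  by exists y => z; rewrite !inE xpair_eqE (negbTE xv) andbF Ey.
- move=> x; rewrite !inE => /andP[xv xS].
  (* Induction from the end of the path: the last vertex but one has an outgoing edge, so it differs
     from [v] and the induction hypothesis applies to it. *)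
  have /connectP[q] := cE x xS; elim/last_ind: q x xv {xS} => [|q y IH] x xv.
    by move=> _ -> .
  rewrite rcons_path last_rcons => /andP[/IH {}IH /= lyE] xy; rewrite {x}xy in xv *.
  have lv : last r q != v by apply: contraTneq lyE => ->.
  apply: connect_trans (IH _ lv erefl) _; apply: connect1.
  by rewrite /= !inE lyE xpair_eqE (negbTE xv) andbF.
Qed.

Lemma outdeg0 E v : outdeg E v = 0 -> forall w, (v, w) \notin E.
Proof.
move=> /eqP; rewrite cards_eq0 => /eqP/setP Ev w.
by have := Ev w; rewrite !inE => ->.
Qed.

Definition trees_with_outdeg S c : {set V * {set V * V}} :=
  [set t | is_tree_on S t.1 t.2 && [forall x in S, outdeg t.2 x == c x]].

Lemma outdegU1 E p v x : (p, v) \notin E ->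
  outdeg ((p, v) |: E) x = (x == p) + outdeg E x.
Proof.
move=> pvE; rewrite /outdeg; have [->|xp] := eqVneq x p.
  rewrite (_ : [set y | _] = v |: [set y | (p, y) \in E]).
    by rewrite cardsU1 inE pvE.
  by apply/setP=> y; rewrite !inE xpair_eqE eqxx.
by apply: eq_card => y; rewrite !inE xpair_eqE (negbTE xp).
Qed.

(** Deleting the leaf [v] with its edge from [p] is a bijection; it lowers the fertility of [p] by
    one. The truncated subtraction is exact because [0 < c p]. *)
Lemma card_trees_with_leaf S c p v :
    v \in S -> p \in S :\ v -> c v = 0 -> 0 < c p ->
  #|[set t in trees_with_outdeg S c | (p, v) \in t.2]| =
  #|trees_with_outdeg (S :\ v) (fun x => c x - (x == p))|.
Proof.
move=> vS pSv cv cp; pose add (t : V * {set V * V}) := (t.1, (p, v) |: t.2).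
have pvNE t : t \in trees_with_outdeg (S :\ v) (fun x => c x - (x == p)) ->
    (p, v) \notin t.2.
  rewrite inE => /andP[/is_tree_onP[_ ES _ _ _] _].
  by apply/negP => /ES[_]; rewrite !inE eqxx.
have add_inj : {in trees_with_outdeg (S :\ v) (fun x => c x - (x == p)) &,
    injective add}.
  move=> [r E] [r' E'] /pvNE/= nE /pvNE/= nE' [-> eqE]; congr (_, _).
  by rewrite -(setU1K nE) eqE setU1K.
have pv : p != v by move: pSv; rewrite !inE => /andP[].
rewrite -(card_in_imset add_inj); apply: eq_card => -[r E]; apply/idP/imsetP.
  rewrite !inE /= => /andP[/andP[tE /forall_inP dE] pvE].
  have leafv : forall w, (v, w) \notin E.
    by apply: outdeg0; rewrite (eqP (dE v vS)).
  have [_ tE'] := remove_leaf tE leafv pvE.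
  exists (r, E :\ (p, v)); last by rewrite /add /= setD1K.
  rewrite inE /= tE'; apply/forall_inP=> x; rewrite !inE => /andP[xv xS].
  rewrite -(eqP (dE x xS)) -{2}(setD1K pvE) outdegU1 ?inE ?eqxx //.
  by rewrite addKn.
move=> [[r' E'] tE' [-> ->]]; have pvE := pvNE _ tE'; move: tE'.
rewrite !inE /= eqxx andbT => /andP[tE' /forall_inP dE'].
rewrite add_leaf //=; apply/forall_inP=> x xS; rewrite outdegU1 //.
(* At [v] both sides are 0: the edges of [E'] stay inside [S :\ v], and [p] is not [v]. *)
have [->|xv] := eqVneq x v.
  rewrite [v == p]eq_sym (negbTE pv) cv add0n cards_eq0; apply/eqP/setP => y.
  have /is_tree_onP[_ ES _ _ _] := tE'.
  by rewrite !inE; apply/negP => /ES[]; rewrite !inE eqxx.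
rewrite (eqP (dE' x _)) ?inE ?xv // subnKC //.
by case: eqP => [->|].
Qed.

(** Splitting by the parent [p] of a fixed leaf gives the recursion of the multinomial coefficients;
    the product form avoids division in [nat]. *)
Theorem card_trees_with_outdeg S c m : #|S| = m.+1 -> \sum_(x in S) c x = m ->
  #|trees_with_outdeg S c| * \prod_(x in S) (c x)`! = m`!.
Proof.
elim: m S c => [|m IH] S c cardS sumc.
  have /cards1P[r Sr] := introT eqP cardS; subst S.
  move: sumc; rewrite !big_set1 => cr; rewrite cr muln1.
  rewrite (_ : trees_with_outdeg _ _ = [set (r, set0)]) ?cards1 //.
  apply/setP=> -[r' E]; rewrite !inE xpair_eqE /=; apply/andP/andP.
    case=> /is_tree_onP[/set1P -> ES rE _ _] _; split=> //.
    (* An edge on a single vertex would have to enter the root. *)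
    apply/eqP/setP=> -[x y]; rewrite inE; apply/negP => xyE.
    have [_ /set1P yr] := ES _ _ xyE.
    by have := rE x; rewrite -yr xyE.
  case=> /eqP -> /eqP ->; split.
    apply/is_tree_onP; split=> //.
    - by rewrite !inE.
    - by move=> x y; rewrite !inE.
    - by move=> x; rewrite !inE.
    - by move=> x /set1P ->; rewrite eqxx.
    - by move=> x /set1P ->.
  apply/forall_inP => x /set1P ->; rewrite cr cards_eq0.
  by apply/eqP/setP => y; rewrite !inE.
(* Otherwise the m + 2 vertices would all have positive fertility, while the total is m + 1. *)
have [v vS cv] : exists2 v, v \in S & c v = 0.
  have [/exists_inP[v vS /eqP cv]|] := boolP [exists v in S, c v == 0].
    by exists v.
  rewrite negb_exists_in => /forall_inP c_gt0.
  have : #|S| <= \sum_(x in S) c x.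
    by rewrite -sum1_card; apply: leq_sum => x xS; rewrite lt0n c_gt0.
  by rewrite cardS sumc ltnn.
have cardSv : #|S :\ v| = m.+1 by move: cardS; rewrite (cardsD1 v) vS => -[].
rewrite (big_setD1 v) //= cv mul1n.
have sumcv : \sum_(x in S :\ v) c x = m.+1.
  by move: sumc; rewrite (big_setD1 v) //= cv.
have -> : #|trees_with_outdeg S c| = \sum_(p in S :\ v | 0 < c p)
    #|trees_with_outdeg (S :\ v) (fun x => c x - (x == p))|.
  under [RHS]eq_bigr => p /andP[pS cp].
    rewrite -card_trees_with_leaf // -sum1dep_card; over.
  rewrite (exchange_big_dep (mem (trees_with_outdeg S c))) /=; last first.
    by move=> p t _ /andP[].
  rewrite -sum1_card; apply: eq_bigr => -[r E] tE.
  rewrite (eq_bigl (fun p => (p, v) \in E)) => [|p]; last first.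
    rewrite tE /=; apply: andb_idl => pvE; move: tE; rewrite inE /=.
    case/andP=> tE /forall_inP dE.
    have leafv : forall w, (v, w) \notin E.
      by apply: outdeg0; rewrite (eqP (dE v vS)).
    have [pSv _] := remove_leaf tE leafv pvE; rewrite pSv /=.
    have pS : p \in S by move: pSv; rewrite inE => /andP[].
    rewrite -(eqP (dE p pS)); apply/card_gt0P; exists v.
    by rewrite inE.
  move: tE; rewrite inE /= => /andP[/is_tree_onP[rS ES rE pE cE] /forall_inP dE].
  (* A leaf that is the root could not reach the other vertices, and [S :\ v] is nonempty. Hence [v]
     has exactly one parent, and each tree is counted once. *)
  have vr : v != r.
    apply/eqP => vr; have [x] : exists x, x \in S :\ v.
      by apply/card_gt0P; rewrite cardSv.
    rewrite !inE => /andP[xv xS]; have /connectP[[|y q] /=] := cE x xS.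
      by move=> _ xr; rewrite xr vr eqxx in xv.
    case/andP=> ryE _ _; have Ev0 : outdeg E v = 0.
      by rewrite (eqP (dE v vS)).
    by have := outdeg0 Ev0 y; rewrite vr ryE.
  have [y Ey] := pE v vS vr.
  by rewrite (eq_bigl (pred1 y)) ?big_pred1_eq.
(* The factor m + 1 is the sum of the [c p], so the identity splits into one equation for each [p];
   the terms with [c p = 0] vanish. Each remaining one is the induction hypothesis multiplied by
   [c p], which restores [(c p)!]. *)
rewrite big_distrl /= -[RHS]/(m.+1 * m`!) -[in RHS]sumcv big_distrl /=.
rewrite [RHS](bigID (fun p => 0 < c p)) /= [X in _ = _ + X]big1 ?addn0; last first.
  by move=> p /andP[_]; rewrite lt0n negbK => /eqP ->.
apply: eq_bigr => p /andP[pS cp].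
rewrite -(IH (S :\ v) (fun x => c x - (x == p))) //; last first.
  move: sumcv; rewrite !(big_setD1 p pS) /= eqxx subn1.
  rewrite [in X in _ -> X](eq_bigr c) => [|x]; last first.
    by rewrite !inE => /andP[/negbTE -> _]; rewrite subn0.
  by rewrite -[in c p + _](prednK cp) addSn => -[].
rewrite mulnCA; congr (_ * _).
rewrite !(big_setD1 p pS) /= eqxx subn1 -[in LHS](prednK cp) factS prednK //.
rewrite mulnA; congr (_ * _); apply: eq_bigr => x.
by rewrite !inE => /andP[/negbTE -> _]; rewrite subn0.
Qed.

End TreesOnSubset.

(** * Multinomial counts of tuples and of functions with given fibre sizes *)

Section Multinomial.
Set Implicit Arguments.
Unset Strict Implicit.
Local Open Scope nat_scope.
Context {J : finType}.

(** Induction on [n] by the first entry [i]: the tails are counted with [k i] lowered by one, and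
    the weights [k i] sum to the new factor of the factorial. *)
Lemma card_tuples_with_counts n (k : J -> nat) : \sum_j k j = n ->
  #|[set t : n.-tuple J | [forall j, count_mem j t == k j]]| *
    \prod_j (k j)`! = n`!.
Proof.
elim: n k => [|n IH] k sumk.
  have k0 j : k j = 0.
    by move/eqP: sumk; rewrite sum_nat_eq0 => /forall_inP/(_ j isT)/eqP.
  rewrite big1 ?muln1 => [|j _]; last by rewrite k0.
  rewrite (_ : [set _ | _] = [set [tuple]]) ?cards1 //.
  by apply/setP=> t; rewrite !inE [t]tuple0 eqxx; apply/forallP=> j; rewrite k0.
pose T (i : J) : {set n.-tuple J} :=
  [set t : n.-tuple J | [forall j, count_mem j t == k j - (j == i)]].
rewrite -sum1_card (partition_big (@thead n J) (fun i => 0 < k i)) /=; last first.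
  move=> t; rewrite inE => /forallP/(_ (thead t))/eqP <-.
  by rewrite {2}(tuple_eta t) /= eqxx.
under eq_bigr => i ki.
  rewrite sum1dep_card (_ : [set _ | _] = [set cons_tuple i t | t in T i]).
    rewrite card_imset; last first.
      by move=> t t' /(congr1 (@tval _ _)) /= [/val_inj].
    over.
  apply/setP=> t; apply/idP/imsetP.
    rewrite !inE => /andP[/forallP tk /eqP ti].
    exists (behead_tuple t); last by rewrite -ti; apply/tuple_eta.
    rewrite inE; apply/forallP=> j; rewrite -(eqP (tk j)).
    by rewrite [in count_mem j t](tuple_eta t) /= ti [j == i]eq_sym addKn.
  move=> [t' t'T ->]; move: t'T; rewrite !inE => /forallP t'k.
  rewrite theadE eqxx andbT; apply/forallP=> j /=.
  rewrite (eqP (t'k j)) [i == j]eq_sym subnKC //.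
  by case: eqP => [->|].
rewrite big_distrl /= -[RHS]/(n.+1 * n`!) -[in RHS]sumk big_distrl /=.
rewrite [RHS](bigID (fun i => 0 < k i)) /= [X in _ = _ + X]big1 ?addn0; last first.
  by move=> i; rewrite lt0n negbK => /eqP ->.
apply: eq_bigr => i ki.
rewrite -(IH (fun j => k j - (j == i))); last first.
  move: sumk; rewrite (bigD1 i) //= [in X in _ -> X](bigD1 i) //= eqxx subn1.
  rewrite [in X in _ -> X](eq_bigr k) => [|j /negbTE ->]; last by rewrite subn0.
  by rewrite -[in k i + _](prednK ki) addSn => -[].
rewrite mulnCA; congr (_ * _).
rewrite (bigD1 i) //= [in RHS](bigD1 i) //= eqxx subn1.
rewrite -[in LHS](prednK ki) factS prednK //.
rewrite mulnA; congr (_ * _); apply: eq_bigr => j /negbTE ->.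
by rewrite subn0.
Qed.

Lemma card_ffuns_with_fibers (I : finType) (k : J -> nat) : \sum_j k j = #|I| ->
  #|[set h : {ffun I -> J} | [forall j, #|[set x | h x == j]| == k j]]| *
    \prod_j (k j)`! = (#|I|)`!.
Proof.
move=> sumk; rewrite -[RHS](card_tuples_with_counts sumk); congr (_ * _).
have fgraph_inj : injective (@fgraph I J) by apply: can_inj (@fgraphK I J).
rewrite -(card_imset _ fgraph_inj); apply: eq_card => t.
rewrite -[t](@FinfunK I J) (mem_imset _ _ fgraph_inj) !inE.
apply: eq_forallb => j; congr (_ == _).
rewrite fgraph_codom /= /codom /image_mem count_map.
by rewrite cardsE cardE size_filter enumT.
Qed.

End Multinomial.

(** * Size of an isomorphism class by orbit counting *)

Section IsoClasses.
Set Implicit Arguments.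
Unset Strict Implicit.
Context {A V : finType}.
Implicit Types t u : dtree A V.

Lemma is_isoP t u (f : {ffun V -> V}) :
  reflect [/\ injective f, f (Defs.root t) = Defs.root u,
      (forall x y, ((f x, f y) \in edges u) = ((x, y) \in edges t)) &
      (forall x, dec u (f x) = dec t x)]
    (is_iso t u f).
Proof.
apply: (iffP and5P) => [[/injectiveP fI _ /eqP fr /forallP fE /forallP fd]|].
  by split=> // [x y|x]; [apply/eqP/(forallP (fE x))|apply/eqP/fd].
case=> fI fr fE fd; split; [exact/injectiveP| |exact/eqP| |].
- by apply/forallP => y; apply/codomP; exists (invF fI y); rewrite f_invF.
- by apply/forallP => x; apply/forallP => y; rewrite fE.
- by apply/forallP => x; rewrite fd.
Qed.

(** Transport of structure along the inverse of [f]. Together with [pullback_tree_unique] it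
    attaches exactly one source tree to each permutation. *)
Lemma pullback_tree u (f : {ffun V -> V}) : injective f ->
  exists t, is_iso t u f.
Proof.
move=> fI; pose g := invF fI.
have fK : cancel f g := invF_f fI; have gK : cancel g f := f_invF fI.
pose E := [set p | (f p.1, f p.2) \in edges u].
have tree_E : is_rooted_tree (g (Defs.root u)) E.
  have /and3P[/forallP r0 /forallP r1 /forallP rc] := valP u.
  apply/and3P; split; apply/forallP => x.
  - by rewrite inE /= gK; apply: r0.
  - apply/implyP => xr; have := implyP (r1 (f x)) _.
    rewrite (can2_eq fK gK) => /(_ xr) /eqP <-; apply/eqP.
    rewrite -(card_imset _ (can_inj fK)); apply: eq_card => y.
    by rewrite -[y]gK (mem_imset _ _ (can_inj fK)) !inE.
  - rewrite -[x]fK; have /connectP[p ep ->] := rc (f x).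
    apply/connectP; exists (map g p); last by rewrite last_map.
    rewrite path_map; apply: sub_path ep => y z /=.
    by rewrite inE /= !gK.
exists (exist _ (g (Defs.root u), E, [ffun i => dec u (f i)]) tree_E : dtree A V).
apply/is_isoP; split=> //.
- exact: gK.
- by move=> x y; rewrite inE.
- by move=> x; rewrite /dec /= ffunE.
Qed.

Lemma pullback_tree_unique t t' u (f : {ffun V -> V}) :
  is_iso t u f -> is_iso t' u f -> t = t'.
Proof.
move=> /is_isoP[fI fr fE fd] /is_isoP[_ fr' fE' fd'].
have Er : Defs.root t = Defs.root t' by apply: fI; rewrite fr fr'.
have EE : edges t = edges t' by apply/setP=> -[x y]; rewrite -fE fE'.
have Ed : dec t = dec t' by apply/ffunP=> x; rewrite -fd fd'.
apply: val_inj; move: Er EE Ed; rewrite /Defs.root /edges /dec.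
by case: (val t) (val t') => [[? ?] ?] [[? ?] ?] /= -> -> ->.
Qed.

(** Composing the automorphisms of [u] with one fixed isomorphism [f0] yields every isomorphism from
    [t] to [u] exactly once. *)
Lemma card_isos t u : isomorphic t u ->
  #|[set f : {ffun V -> V} | is_iso t u f]| = sigma u.
Proof.
case/existsP=> f0 /is_isoP[fI fr fE fd].
pose c (h : {ffun V -> V}) := [ffun x => h (f0 x)].
have c_inj : injective c.
  move=> h h' /ffunP chh'; apply/ffunP=> x; have := chh' (invF fI x).
  by rewrite !ffunE f_invF.
rewrite /sigma -[RHS](card_imset _ c_inj); apply: eq_card => f.
apply/idP/imsetP.
  rewrite inE => /is_isoP[f1I fr1 fE1 fd1]; exists [ffun x => f (invF fI x)].
    rewrite inE; apply/is_isoP; split.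
    - by move=> x y; rewrite !ffunE => /f1I/(can_inj (f_invF fI)).
    - by rewrite ffunE -fr invF_f fr1.
    - by move=> x y; rewrite !ffunE fE1 -fE !f_invF.
    - by move=> x; rewrite ffunE fd1 -fd f_invF.
  by apply/ffunP=> x; rewrite !ffunE invF_f.
case=> h; rewrite inE => /is_isoP[hI hr hE hd] ->; rewrite inE; apply/is_isoP; split.
- by move=> x y; rewrite !ffunE => /hI/fI.
- by rewrite ffunE fr.
- by move=> x y; rewrite !ffunE hE.
- by move=> x; rewrite ffunE hd.
Qed.

(** Double count of the pairs [(t, f)] with [f] an isomorphism from [t] to [u]: each permutation [f]
    occurs with one [t], each [t] in the class with [sigma u] maps [f]. *)
Lemma card_iso_class u :
  (#|[set t : dtree A V | isomorphic t u]| * sigma u = (#|V|)`!)%N.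
Proof.
rewrite -[in RHS]ffactnn -card_inj_ffuns -[RHS]sum1_card.
transitivity (\sum_(f : {ffun V -> V} | injectiveb f)
  \sum_(t | is_iso t u f) 1)%N; last first.
  apply: eq_big => [f|f /injectiveP fI]; first by rewrite inE.
  have [t tuf] := pullback_tree u fI.
  rewrite (eq_bigl (pred1 t)) ?big_pred1_eq // => t'; apply/idP/eqP => [|-> //].
  by move/pullback_tree_unique; apply.
rewrite (exchange_big_dep [in [set t : dtree A V | isomorphic t u]]) /=; last first.
  by move=> f t _ tuf; rewrite inE; apply/existsP; exists f.
rewrite -sum_nat_const; apply: eq_bigr => t; rewrite inE => tu.
rewrite -(card_isos tu) sum1dep_card; apply: eq_card => f; rewrite !inE.
by apply/esym/andb_idl => /is_isoP[/injectiveP].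
Qed.

End IsoClasses.

(** * Labelled trees with a given profile, counted through their vertex labels *)

Section Counting.
Set Implicit Arguments.
Unset Strict Implicit.
Context {A : finType} (k : multiindex A).

(** The fertility of a vertex of index [i], in the form in which it occurs in [kprod]. *)
Definition index_outdeg (i : A * idx) : nat := absz (val i.2 + 1)%R.

Lemma index_outdegE (i : A * idx) : (index_outdeg i)%:Z = val i.2 + 1.
Proof.
rewrite /index_outdeg gez0_abs //.
by have := valP i.2; rewrite -lerBlDr sub0r.
Qed.

(** The sum of [k i] times j + 1 is [wt k + mabs k]; thus the weight condition says that the
    fertilities add up to the number of edges of a tree on [mabs k] vertices. *)
Lemma sum_index_outdeg : wt k = -1 ->
  (\sum_(i <- finsupp k) k i * index_outdeg i)%N.+1 = mabs k.
Proof.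
move=> wtk; apply/eqP; rewrite -eqz_nat -addn1 PoszD; apply/eqP.
rewrite -[mabs k]/(\sum_(i <- finsupp k) k i)%N.
have -> : (\sum_(i <- finsupp k) k i)%N%:Z = \sum_(i <- finsupp k) (k i)%:Z.
  by rewrite -natz natr_sum; apply: eq_bigr => i _; rewrite natz.
have -> : (\sum_(i <- finsupp k) k i * index_outdeg i)%N%:Z =
    \sum_(i <- finsupp k) (val i.2 *+ k i + (k i)%:Z).
  rewrite -natz natr_sum; apply: eq_bigr => i _.
  by rewrite natz PoszM index_outdegE mulrDr mulr1 mulrC -mulr_natr natz.
by rewrite big_split /= -[\sum_(i <- _) val _ *+ _]/(wt k) wtk addrAC addNr add0r.
Qed.

Context {I : finType} (cardI : #|I| = mabs k).

(** Labels are taken in the support of [k] because [A * idx] is not a finite type. *)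
Definition labellings : {set {ffun I -> finsupp k}} :=
  [set h : {ffun I -> finsupp k} |
    [forall j, #|[set x | h x == j]| == k (val j)]].

Definition labelled_by (h : {ffun I -> finsupp k}) (t : dtree A I) :=
  [forall x, (dec t x, predz (fertility t x)) == val (h x)].

Lemma labelled_byE h t x : labelled_by h t ->
  dec t x = (val (h x)).1 /\ fertility t x = index_outdeg (val (h x)).
Proof.
move=> /forallP/(_ x)/eqP <-; split=> //.
by rewrite /index_outdeg /= subrK.
Qed.

(** The profile at [i] is the size of the fibre of [h] over [i]; outside the support of [k] this
    fibre is empty and [k] is 0. *)
Lemma profile_labelled_by h t : labelled_by h t ->
  (profile t == k) = (h \in labellings).
Proof.
move=> ht.
have profE i : profile t i = #|[set x | val (h x) == i]|.
  rewrite profileE; apply: eq_card => x; rewrite !inE.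
  have [-> ->] := labelled_byE x ht; rewrite index_outdegE.
  case: (val (h x)) i => a j [b l] /=; rewrite xpair_eqE; congr (_ && _).
  by rewrite (inj_eq (addIr _)).
rewrite inE; apply/eqP/forallP => [tk j|hk].
  have := profE (val j); rewrite tk => ->; apply/eqP; apply: eq_card => x.
  by rewrite !inE -val_eqE.
apply/fsfunP => i; rewrite profE; have [iS|iNS] := boolP (i \in finsupp k).
  have [j ->] : exists j : finsupp k, i = val j by exists [` iS]%fset.
  by rewrite -(eqP (hk j)); apply: eq_card => x.
rewrite fsfun_dflt //; apply/eqP; rewrite cards_eq0; apply/eqP/setP => x.
by rewrite !inE; apply: contraNF iNS => /eqP <-; apply: valP.
Qed.

Lemma exists_labelling t : profile t = k ->
  exists h, labelled_by h t.
Proof.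
move=> tk.
have tS x : (dec t x, predz (fertility t x)) \in finsupp k.
  rewrite mem_finsupp -tk profileE -lt0n; apply/card_gt0P; exists x.
  by rewrite inE /= eqxx subrK eqxx.
by exists [ffun x => [` tS x]%fset]; apply/forallP => x; rewrite ffunE.
Qed.

Lemma labelled_by_inj t h h' : labelled_by h t -> labelled_by h' t -> h = h'.
Proof.
move=> /forallP ht /forallP h't; apply/ffunP=> x; apply: val_inj.
by rewrite -(eqP (ht x)) -(eqP (h't x)).
Qed.

(** The labelling fixes the decoration, so only the root and the edges remain free, with the
    fertilities prescribed by [h]. *)
Lemma card_labelled_by h : #|[set t : dtree A I | labelled_by h t]| =
  #|trees_with_outdeg setT (fun x => index_outdeg (val (h x)))|.
Proof.
pose shape (t : dtree A I) := (val t).1.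
have shape_inj : {in [set t : dtree A I | labelled_by h t] &, injective shape}.
  move=> t t'; rewrite !inE => ht ht' Es; apply: val_inj.
  rewrite [LHS]surjective_pairing [RHS]surjective_pairing; congr (_, _) => //.
  apply/ffunP=> x; have [Et _] := labelled_byE x ht.
  by have [Et' _] := labelled_byE x ht'; rewrite /dec in Et Et'; rewrite Et Et'.
rewrite -(card_in_imset shape_inj); apply: eq_card => -[r E].
apply/imsetP/idP => [[t]|].
  rewrite !inE => ht Es.
  have [-> ->] : r = Defs.root t /\ E = edges t by rewrite /Defs.root /edges -[(val t).1]Es.
  rewrite is_tree_on_setT (valP t) /=; apply/forall_inP=> x _.
  by have [_ <-] := labelled_byE x ht.
rewrite inE is_tree_on_setT /= => /andP[tE /forall_inP dE].
pose t : dtree A I := exist _ (r, E, [ffun x => (val (h x)).1]) tE.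
have fertE x : fertility t x = index_outdeg (val (h x)).
  exact/eqP/dE/in_setT.
exists t => //; rewrite inE; apply/forallP=> x; apply/eqP; rewrite /dec /= ffunE.
rewrite [RHS]surjective_pairing; congr (_, _); apply: val_inj.
by rewrite /= fertE index_outdegE addrK.
Qed.

Lemma mulL_kprod : wt k = -1 ->
  (L I k * kprod k = (mabs k)`! * (mabs k - 1)`!)%N.
Proof.
move=> wtk.
(* A tree with profile [k] has exactly one labelling, so the trees split according to it. *)
have -> : L I k =
    (\sum_(h in labellings) #|[set t : dtree A I | labelled_by h t]|)%N.
  under eq_bigr do rewrite -sum1dep_card.
  rewrite (exchange_big_dep [in trees_on I k]) /=; last first.
    by move=> h t hk ht; rewrite inE (profile_labelled_by ht).
  rewrite /L -sum1_card; apply: eq_bigr => t tk.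
  have [|h ht] := @exists_labelling t; first by apply/eqP; rewrite inE in tk.
  rewrite (eq_bigl (pred1 h)) ?big_pred1_eq // => h'.
  apply/andP/eqP => [[_ h't]|->]; first exact: labelled_by_inj ht.
  by rewrite -(profile_labelled_by ht); rewrite inE in tk.
have sumk : (\sum_(j : finsupp k) k (val j) = #|I|)%N.
  by rewrite cardI /mabs big_seq_fsetE.
rewrite /kprod big_seq_fsetE big_split /= -/(index_outdeg _).
set P := (\prod_j (k (val j))`!)%N.
set Q := (\prod_(j : finsupp k) (index_outdeg (val j))`! ^ k (val j))%N.
rewrite -[Q]/Q mulnC -mulnA mulnC [(Q * _)%N]mulnC big_distrl /=.
(* The number of trees is the same for every labelling: grouping the vertices by label turns the
   product of their fertility factorials into [Q]. *)
have treesQ h : h \in labellings ->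
    (#|[set t : dtree A I | labelled_by h t]| * Q = (mabs k - 1)`!)%N.
  rewrite inE => /forallP hk; rewrite card_labelled_by.
  have <- : (\prod_(x in [set: I]) (index_outdeg (val (h x)))`! = Q)%N.
    rewrite (partition_big h xpredT) //=; apply: eq_bigr => j _.
    rewrite -(eqP (hk j)) -prod_nat_const; apply: eq_big => [x|x /andP[_ /eqP -> //]].
    by rewrite !inE.
  apply: card_trees_with_outdeg.
    (* The weight condition makes [mabs k] a successor, so the subtraction of 1 is exact. *)
    by rewrite cardsT cardI -sum_index_outdeg // subn1.
  rewrite -(sum_index_outdeg wtk) subn1 /= big_seq_fsetE.
  rewrite (partition_big h xpredT) //=; apply: eq_bigr => j _.
  rewrite -(eqP (hk j)) -sum_nat_const; apply: eq_big => [x|x /andP[_ /eqP -> //]].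
  by rewrite !inE.
rewrite (eq_bigr _ treesQ) sum_nat_const mulnAC.
by rewrite card_ffuns_with_fibers // cardI.
Qed.

End Counting.

(** * From labelled trees to isomorphism classes, and the two formulas *)

Lemma W_trees_on (A : finType) (k : multiindex A) :
  W k = (L 'I_(mabs k) k)%:R / ((mabs k)`!)%:R.
Proof.
set T := trees_on 'I_(mabs k) k; set X := transversal (F k) T.
have eqR : {in T & &, equivalence_rel (@isomorphic A 'I_(mabs k) 'I_(mabs k))}.
  by move=> x y z _ _ _; apply: isomorphic_equiv.
have XT := subsetP (transversal_sub
  (transversalP (equivalence_partitionP eqR))).
(* Each tree with profile [k] is isomorphic to exactly one element of the transversal. *)
have -> : L 'I_(mabs k) k =
    (\sum_(u in X) #|[set t : dtree A 'I_(mabs k) | isomorphic t u]|)%N.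
  under eq_bigr do rewrite -sum1dep_card.
  rewrite (exchange_big_dep [in T]) /=; last first.
    move=> u t /XT; rewrite !inE => /eqP uk /isomorphic_profile ->.
    exact/eqP.
  rewrite /L -sum1_card; apply: eq_bigr => t; rewrite inE => /eqP tk.
  have [u [[uX tu] u_uniq]] := ex_representative tk.
  rewrite (eq_bigl (pred1 u)) ?big_pred1_eq // => u'.
  by apply/andP/eqP => [/u_uniq ->|->].
rewrite natr_sum mulr_suml; apply: eq_bigr => u _.
have cls := card_iso_class u; rewrite card_ord in cls.
have : ((mabs k)`!)%:R != 0 :> rat by rewrite pnatr_eq0 -lt0n fact_gt0.
(* The factorial is the class size times [sigma u], so both factors are nonzero and the class size
   cancels, leaving the inverse of [sigma u]. *)
rewrite -{}cls natrM mulf_eq0 negb_or => /andP[c0 s0].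
by rewrite invfM mulrA mulfV // mul1r.
Qed.

Theorem theorem3p4 (A : finType) (k : multiindex A) (hwt : wt k = -1) :
  let n := mabs k in
  (forall I : finType, #|I| = n ->
     (L I k)%:R = (n`! * (n - 1)`!)%N%:R / (kprod k)%:R :> rat)
  /\ W k = ((n - 1)`!)%N%:R / (kprod k)%:R.
Proof.
move=> n.
have kprod0 : (kprod k)%:R != 0 :> rat.
  rewrite pnatr_eq0 -lt0n prodn_gt0 // => i.
  by rewrite muln_gt0 expn_gt0 !fact_gt0.
have Lk (I : finType) : #|I| = n ->
    (L I k)%:R = (n`! * (n - 1)`!)%N%:R / (kprod k)%:R :> rat.
  by move=> cardI; rewrite -(mulL_kprod cardI hwt) natrM mulfK.
split=> //; rewrite W_trees_on Lk ?card_ord // natrM mulrAC.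
rewrite [(n`!)%:R * _]mulrC mulfK //.
by rewrite pnatr_eq0 -lt0n fact_gt0.
Qed.
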